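(* For every integer $k\ge 0$ and every real $r\ge 0$, there exist $L,C\ge 1$ such that the following holds. If a graph $G$ admits a line-decomposition $(\Lambda,(B_t:t\in \Lambda))$ such that for each $t\in \Lambda$, $B_t$ is the union of at most $k$ sets each with diameter at most $r$ in $G$, then $G$ admits an $(L,C)$-quasi-isometry to a graph with line-width at most $k$.
   Context: Graphs may be infinite, and need not be connected. $\dist_G(u,v)$ is the number of edges in a shortest path of $G$ between $u,v$ ($\infty$ if there is none). The diameter of $X\subseteq V(G)$ in $G$ is the maximum of $\dist_G(u,v)$ over all $u,v\in X$ (distances are measured in $G$, not in $G[X]$). For $L,C\ge 0$, a map $\phi:V(G)\to V(H)$ is an $(L,C)$-quasi-isometry from $G$ to $H$ if: (i) for all $u,v\in V(G)$, if $\dist_G(u,v)$ is finite then $\dist_H(\phi(u),\phi(v))\le L\dist_G(u,v)+C$; (ii) for all $u,v\in V(G)$, if $\dist_H(\phi(u),\phi(v))$ is finite then $\dist_G(u,v)\le L\dist_H(\phi(u),\phi(v))+C$; (iii) for every $y\in V(H)$ there exists $v\in V(G)$ with $\dist_H(\phi(v),y)\le C$. ''$G$ admits an $(L,C)$-quasi-isometry to $H$'' means such a $\phi$ exists. A line is a set $\Lambda$ linearly ordered by a relation $\le_\Lambda$. A line-decomposition of $G$ is a pair $(\Lambda,(B_t:t\in \Lambda))$ where $\Lambda$ is a line and each $B_t\subseteq V(G)$, such that $G=\bigcup_{t\in \Lambda}G[B_t]$, and $B_t\cap B_{t''}\subseteq B_{t'}$ for all $t,t',t''\in \Lambda$ with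 $t\le_\Lambda t'\le_\Lambda t''$. Its width is the maximum of $|B_t|-1$ over $t\in \Lambda$ if this maximum exists, and $\infty$ otherwise; the line-width of $G$ is the minimum width of a line-decomposition of $G$. *)

(* Defs.v *)
From mathcomp Require Import all_boot all_order all_algebra.
From mathcomp Require Import all_classical all_reals ereal.

Set Implicit Arguments.
Unset Strict Implicit.
Unset Printing Implicit Defensive.

Import Order.TTheory GRing.Theory Num.Theory.

Local Open Scope classical_set_scope.
Local Open Scope ring_scope.

(* Simple graphs; the vertex type is arbitrary, hence possibly infinite, and
   no connectedness is assumed. *)
Record graph := Graph {
  vertex :> Type;
  adj : rel vertex;
  adj_sym : symmetric adj;
  adj_irrefl : irreflexive adj
}.

(* [path (@adj G) u p] is a walk with [size p] edges. Repeated vertices are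
   harmless: a shortest walk is a path. The infimum is over a set of naturals,
   hence is its minimum, or +oo if the set is empty. *)
Definition dist (R : realType) (G : graph) (u v : G) : \bar R :=
  ereal_inf [set (size p)%:R%:E | p in
    [set p : seq G | path (@adj G) u p /\ last u p = v]].

(* Equal to -oo if [X] is empty, and to +oo if the distances are unbounded. *)
Definition diameter (R : realType) (G : graph) (X : set G) : \bar R :=
  ereal_sup [set dist R uv.1 uv.2 | uv in X `*` X].

Definition quasi_isometry (R : realType) (L C : R) (G H : graph)
    (phi : G -> H) : Prop :=
  [/\ forall u v : G, (dist R u v < +oo)%E ->
        (dist R (phi u) (phi v) <= L%:E * dist R u v + C%:E)%E,
      forall u v : G, (dist R (phi u) (phi v) < +oo)%E ->
        (dist R u v <= L%:E * dist R (phi u) (phi v) + C%:E)%E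
    & forall y : H, exists v : G, (dist R (phi v) y <= C%:E)%E].

(* The first two clauses say that G is the union of the subgraphs G[B t]. Every
   linearly ordered set is classically an [orderType]. *)
Definition line_decomposition (G : graph) (d : Order.disp_t) (T : orderType d)
    (B : T -> set G) : Prop :=
  [/\ forall v : G, exists t : T, B t v,
      forall u v : G, adj u v -> exists t : T, B t u /\ B t v
    & forall t t' t'' : T, (t <= t')%O -> (t' <= t'')%O ->
        B t `&` B t'' `<=` B t'].

(* The set under the infimum is a singleton if [X] is finite, and is empty, with
   infimum +oo, if [X] is infinite. *)
Definition ecard (R : realType) (V : Type) (X : set V) : \bar R :=
  ereal_inf [set n%:R%:E | n in [set n : nat | (X #= `I_n)%card]].

(* For nonempty [T] the supremum is the maximum, or +oo if there is none. For
   empty [T], which forces G to have no vertices, it is -oo. *)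
Definition width (R : realType) (G : graph) (d : Order.disp_t)
    (T : orderType d) (B : T -> set G) : \bar R :=
  ereal_sup [set (ecard R (B t) - 1)%E | t in [set: T]].

(* Widths are integers or infinite and, for nonempty [T], at least -1, so the
   infimum is attained. *)
Definition line_width (R : realType) (G : graph) : \bar R :=
  ereal_inf [set w | exists (d : Order.disp_t) (T : orderType d)
    (B : T -> set G), line_decomposition B /\ w = width R B].

Definition union_of_at_most (R : realType) (k : nat) (r : R) (G : graph)
    (X : set G) : Prop :=
  exists (j : nat) (Y : 'I_j -> set G),
    [/\ (j <= k)%N, X = \bigcup_i Y i
      & forall i : 'I_j, (diameter R (Y i) <= r%:E)%E].

(* Main.v *)
(* Suppose first that there are finitely many bags, in linear order. Fix scales
   c_0 >> c_1 >> ... >> c_k = r. The level of a bag is the least m such that m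
   balls of radius c_m cover it; being within distance 2 c_m is then an
   equivalence relation on the bag, with at most m classes. Sweeping from left
   to right, keep one centre in each class, preferring older centres; when a
   centre v meets its last bag of level at most that of the current bag, replace
   v by the longest-lasting member of its class. The centres, joined when they
   are simultaneous and close in G, are the vertices of H. The point is that the
   centres seen by a vertex u of G during its lifetime are boundedly far apart
   in H: when a centre that outlasts u is replaced, all later bags containing u
   have strictly larger level, so only boundedly many replacements concern u.

   In general, each finite set F of vertices of G needs only finitely many bags,
   and distances are still measured in G, so the above gives graphs H_F with
   uniform constants. Their ultraproduct over an ultrafilter containing every
   {F : u in F}, cut down to a ball around the image of G, has a
   line-decomposition indexed by the ultraproduct of the lines. *)
Require Import Defs.
From mathcomp Require Import all_boot all_order all_algebra.
From mathcomp Require Import all_classical all_reals ereal.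
From HB Require Import structures.
From mathcomp Require Import generic_quotient.
From mathcomp Require Import zify.

Set Implicit Arguments.
Unset Strict Implicit.
Unset Printing Implicit Defensive.

Import Order.TTheory GRing.Theory Num.Theory.

Local Open Scope classical_set_scope.
Local Open Scope ring_scope.

(** * Walks of bounded length *)

Section Walks.
Local Open Scope nat_scope.
Context (T : Type) (e : rel T).

(** Recursion on [m] rather than a list of vertices: each step is one disjunction and one
    existential, and these pass to an ultraproduct. *)
Fixpoint joined (m : nat) (x y : T) : Prop :=
  if m is m'.+1 then x = y \/ exists2 z, joined m' x z & e z y else x = y.

Lemma joined_refl m x : joined m x x.
Proof. by case: m => //= m; left. Qed.

Lemma joined_step x y : e x y -> joined 1 x y.
Proof. by move=> exy; right; exists x. Qed.

Lemma joined_last m x y : joined m x y -> x = y \/ exists z, e z y.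
Proof.
by case: m => [|m] /=; [left | case=> [|[z _]]; [left | right; exists z]].
Qed.

Lemma joined_leq m n x y : m <= n -> joined m x y -> joined n x y.
Proof.
elim: m n y => [|m IH] [|n] y //= lemn; first by move=> ->; left.
by case=> [->|[z xz zy]]; [left | right; exists z => //; apply: IH xz].
Qed.

Lemma joined_trans m n x y z : joined m x y -> joined n y z -> joined (m + n) x z.
Proof.
move=> xy; elim: n z => [|n IH] z; first by rewrite addn0 => <-.
rewrite addnS => -[<-|[w yw wz]]; first by apply: joined_leq xy; lia.
by right; exists w => //; exact: IH.
Qed.

Lemma joined_sym m x y : symmetric e -> joined m x y -> joined m y x.
Proof.
move=> es; elim: m y => [|m IH] y //= [->|[z xz zy]]; first by left.
have := @joined_trans 1 m y z x; rewrite add1n; apply; last exact: IH.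
by apply: joined_step; rewrite es.
Qed.

Lemma joinedP m x y : joined m x y <->
  exists p, [/\ path e x p, last x p = y & size p <= m].
Proof.
split.
  elim: m y => [|m IH] y /=; first by move=> ->; exists [::].
  case=> [->|[z /IH[p [xp pz sp]] zy]]; first by exists [::].
  exists (rcons p y); rewrite rcons_path last_rcons size_rcons pz xp zy.
  by split.
case=> p [xp <- sp]; apply: (joined_leq sp); move: xp {sp y}.
elim/last_ind: p => [|p y IH] //; rewrite rcons_path last_rcons size_rcons.
by move=> /andP[/IH xp py]; right; exists (last x p).
Qed.

End Walks.

Lemma joined_chain (S T : Type) (e : rel S) (e' : rel T) (f : S -> T) (L m : nat)
    (x y : S) :
  (forall u v, e u v -> joined e' L (f u) (f v)) ->
  joined e m x y -> joined e' (m * L)%N (f x) (f y).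
Proof.
move=> ee'; elim: m y => [|m IH] y; first by move=> ->.
case=> [->|[z xz zy]]; first exact: joined_refl.
by rewrite mulSn addnC; apply: joined_trans (IH _ xz) (ee' _ _ zy).
Qed.

Lemma mem_drop_uniq (T : eqType) (s : seq T) (j : nat) (y : T) : uniq s ->
  (y \in drop j s) = (y \in s) && (j <= index y s)%N.
Proof.
elim: s j => [|x s IH] [|j] //=; first by rewrite andbT.
case/andP=> xs us; rewrite inE eq_sym; case: eqVneq => [<-|_] /=.
  by apply/negP => /mem_drop; rewrite (negPf xs).
by rewrite IH.
Qed.

(** * Finitely many bags *)

Section Finite.
Local Open Scope nat_scope.
(** [near c] stands for distance at most [c] in the whole graph. It is a parameter because the bags
    here are finite traces, and distances must not be measured inside them. *)
Context (V : choiceType) (near : nat -> rel V).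
Hypothesis near_refl : forall c u, near c u u.
Hypothesis near_sym : forall c u v, near c u v -> near c v u.
Hypothesis near_trans : forall a b u v w,
  near a u v -> near b v w -> near (a + b) u w.
Hypothesis near_leq : forall a b u v, a <= b -> near a u v -> near b u v.
Context (k r n : nat) (B : nat -> seq V).
Hypothesis B_convex : forall t t' t'' u, t <= t' -> t' <= t'' ->
  u \in B t -> u \in B t'' -> u \in B t'.
Hypothesis B_end : forall t, n <= t -> B t = [::].
Hypothesis B_cover : forall t, exists Z : seq V,
  size Z <= k /\ forall u, u \in B t -> exists2 z, z \in Z & near r z u.

(* The factor 16 leaves the gap between consecutive scales that [sep_gap] needs. *)
Definition scale m := 16 ^ (k - m) * r.

Definition covered t m := exists Z : seq V, size Z <= m /\
  forall u, u \in B t -> exists2 z, z \in Z & near (scale m) z u.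

Lemma ex_covered t : exists m, `[< covered t m >].
Proof. by exists k; apply/asboolP; rewrite /covered /scale subnn mul1n. Qed.

Definition level t := ex_minn (ex_covered t).

Lemma level_covered t : covered t (level t).
Proof. by rewrite /level; case: ex_minnP => m /asboolP. Qed.

Lemma level_min t m : covered t m -> level t <= m.
Proof. by rewrite /level; case: ex_minnP => m' _ h /asboolP; exact: h. Qed.

Lemma level_leq t : level t <= k.
Proof. by apply: level_min; rewrite /covered /scale subnn mul1n. Qed.

Definition sep m := 2 * scale m.

Lemma sep_leq m m' : m <= m' -> sep m' <= sep m.
Proof.
by move=> mm'; rewrite leq_mul2l leq_mul2r leq_pexp2l ?orbT //; lia.
Qed.

(* If two points of [B t] contradicted this, then one of the [level t] balls
   covering [B t] could be dropped at the cost of passing to the next scale. *)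
Lemma sep_gap t u v : u \in B t -> v \in B t ->
  near (4 * sep (level t)) u v -> near (sep (level t)) u v.
Proof.
move=> ut vt uv; have [Z [sZ cZ]] := level_covered t.
have [z zZ zu] := cZ _ ut; have [z' z'Z z'v] := cZ _ vt.
have [zz'|zz'] := eqVneq z z'.
  rewrite /sep mul2n -addnn; apply: near_trans z'v.
  by apply: near_sym; rewrite -zz'.
exfalso; have lk := level_leq t.
case lE: (level t) => [|m] in sZ lk cZ uv zu z'v *.
  by move: sZ zZ; rewrite leqn0 => /nilP->.
have sE : scale m = 16 * scale m.+1.
  by rewrite /scale mulnA -expnS; congr (16 ^ _ * _); lia.
suff : level t <= m by rewrite lE ltnn.
apply: level_min; exists (rem z' Z); split.
  by rewrite size_rem //; move: sZ; case: (size Z).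
move=> w /cZ[y yZ yw]; have [yz'|yz'] := eqVneq y z'; last first.
  exists y; last by apply: near_leq yw; rewrite sE leq_pmull.
  by move: yZ; rewrite (perm_mem (perm_to_rem z'Z)) inE (negPf yz').
exists z.
  by move: zZ; rewrite (perm_mem (perm_to_rem z'Z)) inE (negPf zz').
rewrite -{}yz' in z'v *.
(* With [c] the current scale, the route from [z] through [u], [v], [z'] to [w] costs 1 + 8 + 1 + 1
   = 11 times [c], within the 16 available. *)
apply: near_leq (near_trans (near_trans zu uv) (near_trans (near_sym z'v) yw)).
by rewrite sE /sep; clear; lia.
Qed.

(** Two members in the same ball of an optimal cover would be within [sep (level t)], so assigning a
    ball to each member is injective. *)
Lemma separated_size t (s : seq (V * nat)) : uniq s ->
  (forall x, x \in s -> x.1 \in B t) ->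
  {in s &, forall x y, near (sep (level t)) x.1 y.1 -> x = y} ->
  size s <= level t.
Proof.
move=> us sB ss; have [Z [sZ cZ]] := level_covered t.
pose f (x : V * nat) := nth x.1 Z (find (near (scale (level t)) ^~ x.1) Z).
have fP x : x \in s ->
    (f x \in Z) * near (scale (level t)) (f x) x.1.
  move=> /sB /cZ[z zZ zx].
  have h : has (near (scale (level t)) ^~ x.1) Z by apply/hasP; exists z.
  by split; [rewrite mem_nth // -has_find | exact: (nth_find x.1 h)].
apply: leq_trans sZ; rewrite -(size_map f); apply: uniq_leq_size.
  rewrite map_inj_in_uniq // => x y xs ys fxy; apply: ss => //.
  rewrite /sep mul2n -addnn.
  apply: near_trans (near_sym (fP x xs).2) _; rewrite fxy; exact: (fP y ys).2.
by move=> _ /mapP[x xs ->]; rewrite (fP x xs).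
Qed.

Lemma seq_argmax (T : eqType) (f : T -> nat) (P : pred T) (s : seq T) x :
  x \in s -> P x ->
  exists y, [/\ y \in s, P y & forall z, z \in s -> P z -> f z <= f y].
Proof.
move=> xs Px.
have [y ys ymax] : exists2 y, y \in seq.filter P s &
    {in seq.filter P s, forall z, f z <= f y}.
  have : x \in seq.filter P s by rewrite mem_filter Px.
  elim: (seq.filter P s) x {xs Px} => // a l IH x _; case: l IH => [|b l] IH.
    by exists a; rewrite ?mem_head // => z; rewrite inE => /eqP->.
  have [y yl ym] := IH b (mem_head _ _).
  have [ay|ay] := leqP (f a) (f y).
    by exists y => [|z]; rewrite in_cons ?yl ?orbT // => /orP[/eqP->//|/ym].
  exists a => [|z]; rewrite in_cons ?eqxx // => /orP[/eqP->//|/ym].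
  by move=> h; exact: leq_trans h (ltnW ay).
move: ys; rewrite mem_filter => /andP[Py ys]; exists y; split => // z zs Pz.
by apply: ymax; rewrite mem_filter Pz.
Qed.

(** * Long-lasting members of a cluster, and the replacement of centres *)

Definition outlasts t (u v : V) := forall t', t <= t' -> u \in B t' -> v \in B t'.

Definition exit u := \max_(i < n | u \in B i) i.

Lemma outlasts_exit t u v : v \in B t -> exit u <= exit v -> outlasts t u v.
Proof.
have ltn_n i w : w \in B i -> i < n.
  by move=> wi; rewrite ltnNge; apply/negP => /B_end Bi; rewrite Bi in wi.
move=> vt uv t' tt' ut'.
have t'v : t' <= exit v.
  apply: leq_trans uv.
  exact: (@leq_bigmax_cond _ (fun i : 'I_n => u \in B i) (@nat_of_ord n)
            (Ordinal (ltn_n _ _ ut')) ut').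
apply: (B_convex tt' t'v vt); rewrite /exit.
have [|i iv ->] := @eq_bigmax_cond _ (fun i : 'I_n => v \in B i) (@nat_of_ord n).
  by apply/card_gt0P; exists (Ordinal (ltn_n _ _ vt)).
exact: iv.
Qed.

Definition longest t y := xget y [set z |
  [/\ z \in B t, near (sep (level t)) y z &
      forall u, u \in B t -> near (sep (level t)) y u -> outlasts t u z]].

(** A cluster member with the largest [exit] outlasts all the others at once, by convexity of the
    bags. *)
Lemma longestP t y : y \in B t ->
  [/\ longest t y \in B t, near (sep (level t)) y (longest t y) &
      forall u, u \in B t -> near (sep (level t)) y u ->
        outlasts t u (longest t y)].
Proof.
move=> yt; rewrite /longest; case: xgetP => [_ _ //|no].
have [z [zt yz zmax]] :=
  @seq_argmax _ exit (near (sep (level t)) y) (B t) y yt (near_refl _ _).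
case: (no z); split => // u ut yu; apply: outlasts_exit => //; exact: zmax.
Qed.

(* A centre is given up at the last moment when its bag is as coarse as it has
   been: from then on every bag containing it splits into more clusters. *)
Definition retiring t v :=
  `[< forall t', t < t' -> v \in B t' -> level t < level t' >].

(* The second component of a centre is the date of its birth. *)
Notation centre := (V * nat)%type.

(** A replacement gets the odd date between the newcomers of [t] and those of [t.+1]. Dates tell
    apart two terms of the same point, which keeps its occurrences in bags convex. *)
Definition replace t (x : centre) : centre :=
  if retiring t x.1 then (longest t x.1, t.*2.+1) else x.

Lemma replaceP t (x : centre) : x.1 \in B t ->
  (replace t x).1 \in B t /\ near (sep (level t)) x.1 (replace t x).1.
Proof. by move=> xt; rewrite /replace; case: ifP => // _; case: (longestP xt). Qed.

(* The later elements of the list have priority. *)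
Fixpoint thin (e : rel centre) (s : seq centre) :=
  if s is x :: s' then
    if has (e x) (thin e s') then thin e s' else x :: thin e s'
  else [::].

Section Thin.
Context (e : rel centre).
Hypothesis e_refl : reflexive e.
Hypothesis e_sym : symmetric e.

Lemma mem_thin s x : x \in thin e s -> x \in s.
Proof.
elim: s => //= y s IH; case: ifP => _; rewrite !inE.
  by move=> /IH->; rewrite orbT.
by case/orP=> [->//|/IH->]; rewrite orbT.
Qed.

Lemma thin_sep s : {in thin e s &, forall x y, e x y -> x = y}.
Proof.
elim: s => //= y s IH; case: ifP => // /hasPn h x z; rewrite !inE.
case/orP=> [/eqP->|xs]; case/orP=> [/eqP->//|zs].
- by move=> yz; have := h _ zs; rewrite yz.
- by rewrite e_sym => yx; have := h _ xs; rewrite yx.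
- exact: IH.
Qed.

Lemma thin_uniq s : uniq (thin e s).
Proof.
elim: s => //= y s IH; case: ifP => //= /hasPn h; rewrite IH andbT.
by apply/negP => /h; rewrite e_refl.
Qed.

(** Dates do not increase along the list, so a survivor that absorbs an element comes later and is
    at least as old. *)
Lemma thin_dom s x : sorted (fun a b => b.2 <= a.2) s -> x \in s ->
  exists2 w, w \in thin e s & e x w /\ w.2 <= x.2.
Proof.
elim: s => //= y s IH ps; rewrite inE => /orP[/eqP->|xs]; last first.
  have [w ws xw] := IH (path_sorted ps) xs.
  by exists w => //; case: ifP => // _; rewrite inE ws orbT.
case: ifP => [/hasP[w ws yw]|_]; last by exists y; rewrite ?mem_head ?e_refl.
exists w => //; split => //; move: ps; rewrite path_sortedE.
  by move=> /andP[/allP/(_ _ (mem_thin ws))].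
by move=> a b c /= ab bc; exact: leq_trans bc ab.
Qed.

End Thin.

(** * The sweep that selects the centres *)

Definition close t : rel centre := fun x y => near (sep (level t)) x.1 y.1.

(** All points of the bag stand with the newest date: the survivors then cover the bag, yet no old
    centre yields to a newcomer. *)
Definition candidates t (s : seq centre) : seq centre :=
  sort (fun a b => b.2 <= a.2)
    ([seq x <- s | x.1 \in B t] ++ [seq (v, t.*2) | v <- B t]).

Fixpoint centres t : seq centre :=
  thin (close t)
    (candidates t (if t is t'.+1 then map (replace t') (centres t') else [::])).

Lemma mem_candidates t s x : (x \in candidates t s) =
  (x.1 \in B t) && (x \in s) || (x \in [seq (v, t.*2) | v <- B t]).
Proof. by rewrite mem_sort mem_cat mem_filter. Qed.

Lemma candidates_sorted t s : sorted (fun a b => b.2 <= a.2) (candidates t s).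
Proof. by apply: sort_sorted => a b; exact: leq_total. Qed.

Definition renewed t := map (replace t) (centres t).

Lemma close_refl t : reflexive (close t).
Proof. by move=> x; exact: near_refl. Qed.

Lemma close_sym t : symmetric (close t).
Proof. by move=> x y; apply/idP/idP; exact: near_sym. Qed.

Lemma centres_uniq t : uniq (centres t).
Proof. by case: t => *; apply: thin_uniq; exact: close_refl. Qed.

Lemma centres_sep t :
  {in centres t &, forall x y, near (sep (level t)) x.1 y.1 -> x = y}.
Proof.
by case: t => [|t] x y xt yt; apply: (thin_sep (@close_sym _) xt yt).
Qed.

Lemma centres_in t x : x \in centres t -> x.1 \in B t.
Proof.
case: t => [|t] /mem_thin; rewrite mem_candidates => /orP[/andP[]//|];
  by case/mapP => v ? ->.
Qed.

Lemma centres_size t : size (centres t) <= k.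
Proof.
apply: leq_trans (level_leq t); apply: separated_size (@centres_sep t).
  exact: centres_uniq.
exact: centres_in.
Qed.

Lemma centres_cover t u : u \in B t ->
  exists2 x, x \in centres t & near (sep (level t)) u x.1.
Proof.
move=> ut; have uc s : (u, t.*2) \in candidates t s.
  by rewrite mem_candidates map_f ?orbT.
case: t ut uc => [|t] ut uc.
  have [w ws [uw _]] := thin_dom (close_refl 0) (candidates_sorted _ _) (uc [::]).
  by exists w.
have [w ws [uw _]] := thin_dom (close_refl t.+1) (candidates_sorted _ _)
  (uc (map (replace t) (centres t))).
by exists w.
Qed.

Lemma centres_birth t x : x \in centres t -> x.2 <= t.*2.
Proof.
elim: t x => [|t IH] x /mem_thin; rewrite mem_candidates => /orP[/andP[_]|] //;
  try by case/mapP => v ? ->.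
case/mapP => y /IH yt ->; rewrite /replace doubleS; case: ifP => _ /=; last first.
  by do 2!apply: leqW.
exact: leqnSn.
Qed.

Lemma renewed_cases t x : x \in renewed t ->
  x \in centres t /\ replace t x = x \/ x.2 = t.*2.+1.
Proof.
case/mapP => y yt ->; rewrite {1 3}/replace; case: ifP => Ry; last by left.
by right; rewrite /replace Ry.
Qed.

Lemma renewed_birth t x : x \in renewed t -> x.2 <= t.*2.+1.
Proof. by case/renewed_cases => [[/centres_birth]|]; lia. Qed.

Lemma renewed_in t x : x \in renewed t -> x.1 \in B t.
Proof. by case/mapP => y /centres_in yt ->; case: (replaceP yt). Qed.

(** Replacing moves a centre by at most one [sep], so close images come from centres within three,
    and [sep_gap] brings this down to one. *)
Lemma renewed_sep t :
  {in renewed t &, forall x y, near (sep (level t)) x.1 y.1 -> x = y}.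
Proof.
move=> _ _ /mapP[x xt ->] /mapP[y yt ->] xy.
have [xB xx] := replaceP (centres_in xt); have [yB yy] := replaceP (centres_in yt).
congr replace; apply: (centres_sep xt yt).
apply: sep_gap; [exact: centres_in xt | exact: centres_in yt |].
apply: near_leq (near_trans (near_trans xx xy) (near_sym yy)); lia.
Qed.

Lemma centres_back t x : x \in centres t.+1 ->
  x \in renewed t \/ x.2 = t.+1.*2.
Proof.
move=> /mem_thin; rewrite mem_candidates => /orP[/andP[_]|].
  by left.
by case/mapP => v ? ->; right.
Qed.

(** The centre absorbing [x] is at least as old, hence no newcomer of [t.+1]. It shares [Hbag t k]
    with [x], so a guide can move to it along an edge. *)
Lemma renewed_next t x : x \in renewed t -> x.1 \in B t.+1 ->
  exists2 w, w \in centres t.+1 &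
    [/\ near (sep (level t.+1)) x.1 w.1, w.2 <= x.2 & w \in renewed t].
Proof.
move=> xt xB.
have [|w wO [xw wx]] := @thin_dom _ (close_refl t.+1) _ x
  (candidates_sorted t.+1 (map (replace t) (centres t))).
  by rewrite mem_candidates xB xt.
exists w => //; split => //; case/centres_back: (wO) => // wE.
by have := renewed_birth xt; rewrite wE in wx; lia.
Qed.

(* The centres of [t] are replaced one at a time, which costs one extra vertex:
   this is the difference between [k] balls and line-width [k]. *)
Definition Hbag t j := map (replace t) (take j.+1 (centres t)) ++ drop j (centres t).

Lemma Hbag_size t j : size (Hbag t j) <= k.+1.
Proof.
rewrite size_cat size_map size_take size_drop.
by have := centres_size t; case: ltnP; lia.
Qed.

Lemma Hbag0 t x : x \in centres t -> x \in Hbag t 0.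
Proof. by move=> xt; rewrite mem_cat drop0 xt orbT. Qed.

Lemma Hbag_renewed t x : x \in renewed t -> x \in Hbag t k.
Proof.
move=> xt; rewrite mem_cat take_oversize; first by rewrite -/(renewed t) xt.
by have := centres_size t; lia.
Qed.

Lemma Hbag_replace t x : x \in centres t ->
  exists j, x \in Hbag t j /\ replace t x \in Hbag t j.
Proof.
move=> xt; exists (index x (centres t)); split; rewrite mem_cat.
  apply/orP; right; rewrite -{1}(nth_index x xt) -{1}[index x _]addn0 -nth_drop.
  by rewrite mem_nth // size_drop subn_gt0 index_mem.
apply/orP; left; apply: map_f.
by rewrite in_take ?ltnSn.
Qed.

Lemma HbagP t j x : x \in Hbag t j <->
  (x \in centres t /\ j <= index x (centres t)) \/
  (exists2 y, y \in centres t /\ index y (centres t) <= j & x = replace t y).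
Proof.
have memd y : y \in drop j (centres t) =
    (y \in centres t) && (j <= index y (centres t)).
  exact/mem_drop_uniq/centres_uniq.
rewrite mem_cat; split.
  case/orP=> [/mapP[y yt ->]|]; last by rewrite memd => /andP[]; left.
  have yO := mem_take yt; rewrite in_take // ltnS in yt.
  by right; exists y.
case=> [[xt jx]|[y [yt yj] ->]]; apply/orP; first by right; rewrite memd xt.
by left; apply: map_f; rewrite in_take.
Qed.


(** Whatever enters after stage [t] has a date above [t.*2.+1], so a centre this old has been
    carried along unchanged. *)
Lemma renewed_back t t' x : t < t' -> x \in centres t' -> x.2 <= t.*2.+1 ->
  x \in renewed t.
Proof.
elim: t' => // t' IH; rewrite ltnS leq_eqVlt => /orP[/eqP->|tt'].
  by move=> /centres_back[]// ->; rewrite doubleS ltnn.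
have lt2 : t.*2.+1 < t'.*2 by rewrite -!muln2; lia.
move=> /centres_back[|->] xt; last by move: xt; rewrite doubleS; lia.
case/renewed_cases: (xt) => [[x' _] |-> ]; first exact: IH.
by rewrite ltnS; lia.
Qed.

Lemma Hbag_fixed t j x : x \in centres t -> replace t x = x -> x \in Hbag t j.
Proof.
move=> xt xx; apply/HbagP.
have [?|h] := leqP j (index x (centres t)); [by left|right].
by exists x; rewrite // (ltnW h).
Qed.

Lemma Hbag_mem t j x : x \in Hbag t j -> x \in centres t \/ x \in renewed t.
Proof.
case/HbagP => [[]|[y [yt _] ->]]; first by left.
by right; exact: map_f.
Qed.

Lemma Hbag_birth t j x : x \in Hbag t j -> x.2 <= t.*2.+1.
Proof. by case/Hbag_mem => [/centres_birth/leqW|/renewed_birth]. Qed.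

Lemma Hbag_old t j x : x \in Hbag t j -> x.2 <= t.*2 -> x \in centres t.
Proof.
case/Hbag_mem => // /renewed_cases[[]//|->]; lia.
Qed.

(** * Linear order of the bags, and edges between centres *)

Definition date_leq (p q : nat * nat) :=
  (p.1 < q.1) || (p.1 == q.1) && (p.2 <= q.2).

(** A vertex carried through a whole stage is fixed by [replace] and lies in all bags of the stage.
    Otherwise, within a stage, a retiring centre occupies an initial run of bags and a newborn
    replacement a final run. *)
Lemma Hbag_convex p q p' x : date_leq p q -> date_leq q p' ->
  x \in Hbag p.1 p.2 -> x \in Hbag p'.1 p'.2 -> x \in Hbag q.1 q.2.
Proof.
case: p q p' => [t1 j1] [t j] [t2 j2]; rewrite /date_leq /= => le1 le2 x1 x2.
have b1 := Hbag_birth x1.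
have pers : t1 < t2 -> x \in centres t2 by move=> lt; apply: (Hbag_old x2); lia.
case/orP: le1 => [lt1|/andP[/eqP e1 lj1]]; case/orP: le2 => [lt2|/andP[/eqP e2 lj2]].
- have : x \in renewed t by apply: (renewed_back lt2); [apply: pers|]; lia.
  by case/renewed_cases => [[xt xx]|]; [exact: Hbag_fixed | lia].
- subst t; have xt := pers lt1.
  case/HbagP: (x2) => [[_ h]|[y [yt _] xy]].
    by apply/HbagP; left; split => //; lia.
  apply: Hbag_fixed => //.
  have : x \in renewed t2 by rewrite xy; exact: map_f.
  by case/renewed_cases => [[]|] //; lia.
- subst t1; have xr : x \in renewed t.
    by apply: (renewed_back lt2) => //; exact: pers.
  case/renewed_cases: (xr) => [[xt xx]|xb]; first exact: Hbag_fixed.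
  case/HbagP: x1 => [[/centres_birth]|[y [yt yj] xy]]; first lia.
  by apply/HbagP; right; exists y => //; split => //; lia.
- subst t1 t2; case/HbagP: (x2) => [[xt h]|[y [yt yj] xy]].
    by apply/HbagP; left; split => //; lia.
  case/HbagP: x1 => [[xt h]|[z [zt zj] xz]]; last first.
    by apply/HbagP; right; exists z => //; split => //; lia.
  have : x \in renewed t by rewrite xy; exact: map_f.
  case/renewed_cases => [[_ xx]|]; first exact: Hbag_fixed.
  by have := centres_birth xt; lia.
Qed.

(** A guide is within [sep 0 * (k + 2)] of [u], and the centre it is compared with within [sep 0].
    The 1 pays for an edge of the original graph. *)
Definition reach := sep 0 * (k + 4) + 1.

Definition Hadj : rel centre := fun x y => [&& x != y, near reach x.1 y.1 &
  `[< exists t j, x \in Hbag t j /\ y \in Hbag t j >]].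

Lemma Hadj_sym : symmetric Hadj.
Proof.
move=> x y; rewrite /Hadj eq_sym; congr [&& _, _ & _].
  by apply/idP/idP; exact: near_sym.
by apply/asboolP/asboolP => -[t [j []]]; exists t, j.
Qed.

Lemma Hadj_irrefl : irreflexive Hadj.
Proof. by move=> x; rewrite /Hadj eqxx. Qed.

Lemma Hadj_joined t j c x y : x \in Hbag t j -> y \in Hbag t j ->
  c <= reach -> near c x.1 y.1 -> joined Hadj 1 x y.
Proof.
move=> xt yt cr xy; case: (eqVneq x y) => [->|nxy]; first exact: joined_refl.
apply: joined_step; rewrite /Hadj nxy (near_leq cr xy); apply/asboolP.
by exists t, j.
Qed.

Lemma sep_max m : sep m <= sep 0.
Proof. exact: sep_leq. Qed.

Definition guarded (S : seq centre) m (x : centre) := forall w : centre,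
  w \in S -> w.2 <= x.2 -> w != x -> ~~ near (sep m) w.1 x.1.

(* A guide for [u] is a centre that stays near [u] and is given up only boundedly
   often, because each change decreases the rank [rho]. In the first case its
   next retirement happens at level [m], where it is in the cluster of [u]; in
   the other two cases it outlasts [u], and in the third case only finer levels
   are still to come in the lifetime of [u]. Being [guarded], it is never
   discarded in favour of an older centre as long as the level is at least [m]. *)
Definition guide u t (S : seq centre) s rho (x : centre) := exists m,
  [/\ x \in S, m <= level t, guarded S m x &
  [\/ [/\ rho = k + 2 + m.*2, near (sep m) u x.1 &
        exists2 t', s <= t' & x.1 \in B t' /\ level t' <= m],
      [/\ rho = k + 1 + m.*2, near (sep m) u x.1 & outlasts s u x.1] |
      [/\ rho + m = k, near (sep 0 * (m + 2)) u x.1, outlasts s u x.1 &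
        forall t', s <= t' -> u \in B t' -> m < level t']]].

Lemma guide_replace u t rho x : u \in B t -> guide u t (centres t) t rho x ->
  exists rho' x', [/\ guide u t (renewed t) t.+1 rho' x', rho' <= rho &
    joined Hadj (rho - rho') x x'].
Proof.
move=> ut [m [xt mt gx cases]]; have xB := centres_in xt.
have xs := sep_max (level t).
have [j [xj x'j]] := Hbag_replace xt.
have [x'B xx'] := replaceP xB.
have hop : joined Hadj 1 x (replace t x).
  by apply: (Hadj_joined xj x'j _ xx'); rewrite /reach; nia.
case Rx : (retiring t x.1); last first.
  have xx : replace t x = x by rewrite /replace Rx.
  have xr : x \in renewed t by rewrite -xx; exact: map_f.
  exists rho, x; split => //; last by rewrite subnn.
  exists m; split => //.
    move=> w wr wx; apply: gx => //; case/renewed_cases: (wr) => [[]//|wE].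
    by have := leq_trans wx (centres_birth xt); rewrite wE ltnn.
  have later s : outlasts t u s -> outlasts t.+1 u s.
    by move=> h t' tt'; apply: h; exact: ltnW.
  case: cases => [[-> ux [t' tt' [xt' lt']]]|[-> ux uo]|[rE ux uo ul]].
  - constructor 1; split => //; move: tt'; rewrite leq_eqVlt.
    case/orP=> [/eqP tt'|tt']; last by exists t'.
    move/asboolPn: Rx => /existsNP[t'' /not_implyP[tt'' /not_implyP[xt'' /negP]]].
    rewrite -leqNgt => lt''; exists t'' => //; split => //.
    by rewrite -tt' in lt'; exact: leq_trans lt'' lt'.
  - by constructor 2; split => //; exact: later.
  - constructor 3; split => //; first exact: later.
    by move=> t' tt'; apply: ul; exact: ltnW.
have x'r : replace t x \in renewed t by exact: map_f.
have x'E : replace t x = (longest t x.1, t.*2.+1) by rewrite /replace Rx.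
have [_ _ lP] := longestP xB.
have gx' : guarded (renewed t) (level t) (replace t x).
  by move=> w wr _; apply: contra => wx; apply/eqP; exact: (renewed_sep wr x'r).
have retire t' : t < t' -> x.1 \in B t' -> level t < level t'.
  by move/asboolP: Rx => h; exact: h.
have xo : outlasts t x.1 (replace t x).1 by rewrite x'E; apply: lP.
case: cases => [[-> ux [t' tt' [xt' lt']]]|[-> ux uo]|[rE ux uo ul]].
(* Retirement forces [t' = t], so [x] retires at level exactly [m]. Its cluster contains [u], hence
   the longest-lasting member outlasts [u]. *)
- have tE : t' = t.
    apply/eqP; rewrite eqn_leq tt' andbT leqNgt; apply/negP => lt.
    by have := leq_trans (retire _ lt xt') lt'; rewrite ltnNge mt.
  have mE : m = level t by apply/eqP; rewrite eqn_leq mt -tE lt'.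
  subst m; exists (k + 1 + (level t).*2), (replace t x); split; last 2 [clear; lia].
  - exists (level t); split => //; constructor 2; split => //.
      apply: sep_gap => //; apply: near_leq (near_trans ux xx'); clear; lia.
    move=> s ts us; rewrite x'E; apply: (lP u) => //; first exact: near_sym.
    exact: ltnW.
  - by apply: joined_leq hop; clear; lia.
(* Since [x] outlasts [u], every later bag with [u] contains [x], and retirement makes its level
   larger than [level t]. *)
- have lk := level_leq t.
  exists (k - level t), (replace t x); split; last 2 [clear; lia].
  - exists (level t); split => //; constructor 3; split; first exact: subnK.
    + apply: near_leq (near_trans ux xx'); have sm := sep_max m; clear -sm xs; nia.
    + move=> s ts us; apply: xo; first exact: ltnW.
      by apply: uo => //; exact: ltnW.
    + move=> s ts us; apply: retire => //; apply: uo => //; exact: ltnW.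
  - by apply: joined_leq hop; clear; lia.
(* The growth of the level absorbs the extra [sep 0] in the bound [sep 0 * (m + 2)]. *)
- have lk := level_leq t; have ml := ul _ (leqnn t) ut.
  exists (k - level t), (replace t x); split; last 2 [clear -rE ml lk; lia].
  - exists (level t); split => //; constructor 3; split; first exact: subnK.
    + apply: near_leq (near_trans ux xx'); clear -xs ml; nia.
    + move=> s ts us; apply: xo; first exact: ltnW.
      by apply: uo => //; exact: ltnW.
    + move=> s ts us; apply: retire => //; apply: uo => //; exact: ltnW.
  - by apply: joined_leq hop; clear -rE ml lk; lia.
Qed.

(** While the level is at least [m], being guarded saves the guide. If the level falls below [m],
    the third case is excluded, and the absorbing centre becomes a guide of the first case at the
    new level. *)
Lemma guide_next u t rho x : u \in B t.+1 ->
  guide u t (renewed t) t.+1 rho x ->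
  exists rho' x', [/\ guide u t.+1 (centres t.+1) t.+1 rho' x', rho' <= rho &
    joined Hadj (rho - rho') x x'].
Proof.
move=> ut [m [xt mt gx cases]].
have xB : x.1 \in B t.+1.
  case: cases => [[_ _ [t' tt' [xt' _]]]|[_ _ uo]|[_ _ uo _]]; try exact: uo.
  exact: B_convex (leqnSn t) tt' (renewed_in xt) xt'.
have [w wt [xw wx wr]] := renewed_next xt xB.
have [lm|ml] := leqP m (level t.+1).
  have xw' : w = x.
    apply/eqP; apply: contraT => /(gx _ wr wx)/negP[].
    by apply: near_leq (near_sym xw); exact: sep_leq.
  subst w; exists rho, x; split => //; last by rewrite subnn.
  exists m; split => // w wt' wx'; apply: gx => //.
  case/centres_back: wt' => // wE.
  by have := leq_trans wx' (renewed_birth xt); rewrite wE doubleS ltnn.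
have ux : near (sep m) u x.1.
  by case: cases => [[]|[]|[_ _ _ /(_ _ (leqnn _) ut)]] //; lia.
have lk := level_leq t.
exists (k + 2 + (level t.+1).*2), w.
(* The doubling of [m] in the ranks makes this strict even on the way from the second case back to
   the first. *)
have le : k + 2 + (level t.+1).*2 < rho.
  by case: cases => [[]|[]|[_ _ _ /(_ _ (leqnn _) ut)]] //; lia.
split; last 2 [exact: ltnW].
  exists (level t.+1); split => //.
    by move=> y yt _; apply: contra => yw; apply/eqP; exact: (centres_sep yt wt).
  constructor 1; split => //; last first.
    by exists t.+1 => //; split => //; exact: centres_in.
  apply: sep_gap => //; first exact: centres_in.
  by apply: near_leq (near_trans ux xw); have := sep_leq (ltnW ml); lia.
apply: (@joined_leq _ _ 1); first lia.
apply: (Hadj_joined (Hbag_renewed xt) (Hbag_renewed wr) _ xw).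
by have := sep_max (level t.+1); rewrite /reach; nia.
Qed.

Lemma guide_from u t t' rho x : t <= t' -> u \in B t -> u \in B t' ->
  guide u t (centres t) t rho x ->
  exists rho' x', [/\ guide u t' (centres t') t' rho' x', rho' <= rho &
    joined Hadj (rho - rho') x x'].
Proof.
move=> tt' ut; elim: t' tt' => [|t' IH].
  rewrite leqn0 => /eqP t0; subst t => _ g.
  by exists rho, x; split => //; exact: joined_refl.
rewrite leq_eqVlt => /orP[/eqP<- _ g|tt' ut' g].
  by exists rho, x; split => //; exact: joined_refl.
have ut1 : u \in B t' by exact: B_convex (ltnSE tt') (leqnSn _) ut ut'.
have [r1 [x1 [g1 le1 w1]]] := IH (ltnSE tt') ut1 g.
have [r2 [x2 [g2 le2 w2]]] := guide_replace ut1 g1.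
have [r3 [x3 [g3 le3 w3]]] := guide_next ut' g2.
exists r3, x3; split => //; first lia.
by apply: joined_leq (joined_trans (joined_trans w1 w2) w3); lia.
Qed.

Lemma guide_near u t S s rho x : guide u t S s rho x ->
  near (sep 0 * (k + 2)) u x.1.
Proof.
case=> m [_ mt _ cases]; have := leq_trans mt (level_leq t) => mk.
have sm := sep_max m.
by case: cases => [[_ ux _]|[_ ux _]|[_ ux _ _]]; apply: near_leq ux; nia.
Qed.

(** The centre [x] is itself a guide of the first case, of rank at most [3 * k + 2]. It is followed
    up to [t'], where one more edge reaches [x']. *)
Lemma seen_joined u t t' x x' : t <= t' -> u \in B t -> u \in B t' ->
  x \in centres t -> x' \in centres t' ->
  near (sep (level t)) u x.1 -> near (sep (level t')) u x'.1 ->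
  joined Hadj (3 * k + 3) x x'.
Proof.
move=> tt' ut ut' xt x't' ux ux'; have lk := level_leq t.
have [|rho [y [gy _ xy]]] := @guide_from u t t' (k + 2 + (level t).*2) x tt' ut ut'.
  exists (level t); split => //; last first.
    by constructor 1; split => //; exists t => //; split => //; exact: centres_in.
  by move=> y yt _; apply: contra => yw; apply/eqP; exact: (centres_sep yt xt).
have yt' : y \in centres t' by case: gy => m [].
have yx' : joined Hadj 1 y x'.
  apply: (Hadj_joined (Hbag0 yt') (Hbag0 x't') _
            (near_trans (near_sym (guide_near gy)) ux')).
  by have := sep_max (level t'); rewrite /reach; nia.
by apply: joined_leq (joined_trans xy yx'); lia.
Qed.

(** [phi u] is any centre near [u] in any bag of [u]. For [u] and [v] in a common bag, walks of
    [3 * k + 3] steps lead from both images to centres of that bag near [u] and [v], which are at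
    most one edge apart. *)
Lemma finite_stage : exists (Ha : rel centre) (Hb : nat * nat -> seq centre)
    (phi : V -> centre), [/\
  symmetric Ha /\ irreflexive Ha,
  forall p, size (Hb p) <= k.+1,
  forall p q p' x, date_leq p q -> date_leq q p' ->
    x \in Hb p -> x \in Hb p' -> x \in Hb q,
  forall x y, Ha x y -> near reach x.1 y.1 /\
    exists p, x \in Hb p /\ y \in Hb p &
  (forall t u, u \in B t -> (exists p, phi u \in Hb p) /\
    near (sep 0) u (phi u).1) /\
  forall t u v, u \in B t -> v \in B t -> near 1 u v ->
    joined Ha (6 * k + 7) (phi u) (phi v)].
Proof.
have phiP u : exists x : centre, forall t, u \in B t ->
    exists t', [/\ u \in B t', x \in centres t' & near (sep (level t')) u x.1].
  have [[t ut]|no] := pselect (exists t, u \in B t); last first.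
    by exists (u, 0) => t ut; case: no; exists t.
  by have [x xt ux] := centres_cover ut; exists x => _ _; exists t.
have [phi {}phiP] := choice phiP.
exists Hadj, (fun p => Hbag p.1 p.2), phi; split.
- by split; [exact: Hadj_sym | exact: Hadj_irrefl].
- by move=> p; exact: Hbag_size.
- exact: Hbag_convex.
- move=> x y /and3P[_ xy /asboolP[t [j xyj]]]; split => //.
  by exists (t, j).
have seen u t x : u \in B t -> x \in centres t -> near (sep (level t)) u x.1 ->
    joined Hadj (3 * k + 3) (phi u) x.
  move=> ut xt ux; have [t' [ut' yt' uy]] := phiP _ _ ut.
  have [tt'|tt'] := leqP t t'; last exact: (seen_joined (ltnW tt') ut' ut).
  by apply: joined_sym Hadj_sym _; exact: (seen_joined tt' ut ut').
split=> [t u ut|t u v ut vt uv].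
  have [t' [ut' xt' ux]] := phiP _ _ ut; split.
    by exists (t', 0); exact: Hbag0.
  by apply: near_leq ux; exact: sep_max.
have [x xt ux] := centres_cover ut; have [y yt vy] := centres_cover vt.
have xy : joined Hadj 1 x y.
  apply: (Hadj_joined (Hbag0 xt) (Hbag0 yt) _
    (near_trans (near_trans (near_sym ux) uv) vy)).
  by have := sep_max (level t); rewrite /reach; nia.
apply: joined_leq (joined_trans (joined_trans (seen _ _ _ ut xt ux) xy)
  (joined_sym Hadj_sym (seen _ _ _ vt yt vy))).
lia.
Qed.

End Finite.

(** * Ultraproducts of graphs with line-decompositions *)

Section Ultrapower.
Local Open Scope quotient_scope.
Context (I : Type) (U : set_system I) (UU : UltraFilter U).

Lemma ultra_or (A A' : set I) : U (A `|` A') -> U A \/ U A'.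
Proof.
move=> UAA; have [|nA] := in_ultra_setVsetC A UU; first by left.
by right; apply: filterS (filterI UAA nA) => i [[]].
Qed.

Lemma ultra_pigeonhole (n : nat) (A : nat -> set I) :
  U [set i | exists2 j, (j < n)%N & A j i] -> exists2 j, (j < n)%N & U (A j).
Proof.
elim: n => [|n IH] UA; first by have /filter_ex[i []] := UA.
have : U ([set i | exists2 j, (j < n)%N & A j i] `|` A n).
  apply: filterS UA => i [j]; rewrite ltnS leq_eqVlt.
  by case/orP=> [/eqP->|jn] Aj; [right | left; exists j].
by case/ultra_or=> [/IH[j /ltnW jn]|]; [exists j | exists n].
Qed.

Section Quotient.
Context (T : Type).

Definition ultra_eq (f g : {classic (I -> T)}) : bool :=
  `[< U [set i | f i = g i] >].

Lemma ultra_eq_refl : reflexive ultra_eq.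
Proof. by move=> f; apply/asboolP; apply: filterS filterT. Qed.

Lemma ultra_eq_sym : symmetric ultra_eq.
Proof. by move=> f g; apply/asboolP/asboolP; apply: filterS => i /= ->. Qed.

Lemma ultra_eq_trans : transitive ultra_eq.
Proof.
move=> g f h /asboolP fg /asboolP gh; apply/asboolP.
by apply: filterS (filterI fg gh) => i [/= -> ->].
Qed.

Canonical ultra_eq_equiv :=
  EquivRel ultra_eq ultra_eq_refl ultra_eq_sym ultra_eq_trans.

(** A power is enough: all stages share the vertex type and the line, and only their relations
    depend on the index. *)
Definition ultrapower := {eq_quot ultra_eq_equiv}.
HB.instance Definition _ := Choice.on ultrapower.

Definition uclass (f : I -> T) : ultrapower := \pi_ultrapower%qT f.
Definition urepr (x : ultrapower) : I -> T := repr x.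

Lemma uclass_repr f : U [set i | urepr (uclass f) i = f i].
Proof.
apply/asboolP; rewrite -[`[< _ >]]/(ultra_eq_equiv (repr (uclass f)) f).
by rewrite -eqmodE reprK.
Qed.

Lemma urepr_eq x y : U [set i | urepr x i = urepr y i] -> x = y.
Proof.
move=> xy; rewrite -[x]reprK -[y]reprK; apply/eqP; rewrite eqmodE.
exact/asboolP.
Qed.

Lemma uclass_eq f x : U [set i | f i = urepr x i] -> uclass f = x.
Proof.
move=> fx; apply: urepr_eq; apply: filterS (filterI (uclass_repr f) fx).
by move=> i [/= -> ->].
Qed.

End Quotient.

Section UltraOrder.
Context (d : Order.disp_t) (T : orderType d).

Definition ultra_le (x y : ultrapower T) : bool :=
  `[< U [set i | (urepr x i <= urepr y i)%O] >].

Lemma ultra_le_refl : reflexive ultra_le.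
Proof. by move=> x; apply/asboolP; apply: filterS filterT => i _ /=. Qed.

Lemma ultra_le_anti : antisymmetric ultra_le.
Proof.
move=> x y /andP[/asboolP xy /asboolP yx]; apply: urepr_eq.
by apply: filterS (filterI xy yx) => i [/= xyi yxi]; apply: le_anti; rewrite xyi.
Qed.

Lemma ultra_le_trans : transitive ultra_le.
Proof.
move=> y x z /asboolP xy /asboolP yz; apply/asboolP.
by apply: filterS (filterI xy yz) => i [/= xyi]; exact: le_trans.
Qed.

Lemma ultra_le_total : total ultra_le.
Proof.
move=> x y; suff : U ([set i | (urepr x i <= urepr y i)%O] `|`
                       [set i | (urepr y i <= urepr x i)%O]).
  by case/ultra_or => h; apply/orP; [left | right]; exact/asboolP.
by apply: filterS filterT => i _; exact/orP/le_total.
Qed.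

HB.instance Definition _ := Order.Le_isPOrder.Build d (ultrapower T)
  ultra_le_refl ultra_le_anti ultra_le_trans.
HB.instance Definition _ := Order.POrder_isTotal.Build d (ultrapower T)
  ultra_le_total.

Lemma ultra_leP (x y : ultrapower T) :
  (x <= y)%O -> U [set i | (urepr x i <= urepr y i)%O].
Proof. by move/asboolP. Qed.

End UltraOrder.

Section UltraGraph.
Context (X V : Type) (d : Order.disp_t) (L : orderType d) (x0 : X) (l0 : L).
Context (Ha : I -> rel X) (Hb : I -> L -> set X) (phi : I -> V -> X) (k M : nat).
Hypothesis Ha_sym : forall i, symmetric (Ha i).
Hypothesis Ha_irrefl : forall i, irreflexive (Ha i).
Hypothesis Hb_size : forall i l, exists e : nat -> X,
  Hb i l `<=` e @` `I_k.+1.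
Hypothesis Hb_convex : forall i l l' l'', (l <= l')%O -> (l' <= l'')%O ->
  Hb i l `&` Hb i l'' `<=` Hb i l'.
Hypothesis Ha_bag : forall i x y, Ha i x y -> exists l, Hb i l x /\ Hb i l y.
Hypothesis phi_bag : forall v, U [set i | exists l, Hb i l (phi i v)].

Definition uadj : rel (ultrapower X) := fun x y =>
  `[< U [set i | Ha i (urepr x i) (urepr y i)] >].

Definition uphi v := uclass (phi^~ v).

Lemma uadj_sym : symmetric uadj.
Proof.
by move=> x y; apply/asboolP/asboolP; apply: filterS => i /=; rewrite Ha_sym.
Qed.

Lemma uadj_irrefl : irreflexive uadj.
Proof.
move=> x; apply/negP => /asboolP /filter_ex[i /=].
by rewrite Ha_irrefl.
Qed.

(** One direction of the theorem of Los, for walks of a fixed bound: the ultrafilter decides between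
    the disjuncts, and the last vertex but one is chosen in each factor. *)
Lemma joined_uclass m f g : U [set i | joined (Ha i) m (f i) (g i)] ->
  joined uadj m (uclass f) (uclass g).
Proof.
elim: m g => [|m IH] g fg.
  apply: uclass_eq; apply: filterS (filterI fg (uclass_repr g)).
  by move=> i [/= -> ->].
have : U ([set i | f i = g i] `|`
    [set i | exists2 z, joined (Ha i) m (f i) z & Ha i z (g i)]).
  by apply: filterS fg.
case/ultra_or => fgU.
  left; apply: uclass_eq; apply: filterS (filterI fgU (uclass_repr g)).
  by move=> i [/= -> ->].
right; pose h i :=
  @xget {classic X} x0 [set z | joined (Ha i) m (f i) z /\ Ha i z (g i)].
have hP : U [set i | joined (Ha i) m (f i) (h i) /\ Ha i (h i) (g i)].
  apply: filterS fgU => i [z fz zg].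
  exact: (@xgetPex {classic X} x0 [set z | joined (Ha i) m (f i) z /\ Ha i z (g i)]
    (ex_intro _ z (conj fz zg))).
exists (uclass h); first by apply: IH; apply: filterS hP => i [].
apply/asboolP.
apply: filterS (filterI hP (filterI (uclass_repr h) (uclass_repr g))).
by move=> i [[_ hg] [/= -> ->]].
Qed.

Lemma joined_urepr m x y : joined uadj m x y ->
  U [set i | joined (Ha i) m (urepr x i) (urepr y i)].
Proof.
elim: m y => [|m IH] y /=; first by move=> ->; apply: filterS filterT.
case=> [->|[z /IH xz /asboolP zy]]; first by apply: filterS filterT; left.
by apply: filterS (filterI xz zy) => i [/= xzi zyi]; right; exists (urepr z i).
Qed.

(* Only the [M]-ball around the image of [uphi] is kept: the ultraproduct may
   have vertices that are far from every standard one. *)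
Definition uvertex := {x : ultrapower X | `[< exists v, joined uadj M (uphi v) x >]}.

Definition ugraph : graph := @Graph uvertex (fun x y => uadj (val x) (val y))
  (fun x y => uadj_sym (val x) (val y)) (fun x => uadj_irrefl (val x)).

Lemma umap_subproof v : `[< exists v', joined uadj M (uphi v') (uphi v) >].
Proof. by apply/asboolP; exists v; exact: joined_refl. Qed.

Definition umap v : ugraph := exist _ (uphi v) (umap_subproof v).

(** A walk of at most [M] steps from an image never leaves the ball that is kept. *)
Lemma joined_ball m v (y : ugraph) : (m <= M)%N ->
  joined uadj m (uphi v) (val y) -> joined (@adj ugraph) m (umap v) y.
Proof.
elim: m y => [|m IH] y mM /=; first by move=> vy; apply: val_inj.
case=> [vy|[z vz zy]]; first by left; apply: val_inj.
have zb : `[< exists v, joined uadj M (uphi v) z >].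
  by apply/asboolP; exists v; apply: joined_leq vz; exact: ltnW.
by right; exists (exist _ z zb) => //; apply: IH => //; exact: ltnW.
Qed.

Lemma joined_ugraph m (x y : ugraph) : joined (@adj ugraph) m x y ->
  joined uadj m (val x) (val y).
Proof.
elim: m y => [|m IH] y /=; first by move=> ->.
by case=> [->|[z xz zy]]; [left | right; exists (val z) => //; exact: IH].
Qed.

Lemma ugraph_near (y : ugraph) : exists v, joined (@adj ugraph) M (umap v) y.
Proof. by case: (asboolW (valP y)) => v vy; exists v; exact: joined_ball. Qed.

Definition ubag (l : ultrapower L) : set (ultrapower X) :=
  [set x | U [set i | Hb i (urepr l i) (urepr x i)]].

Lemma ubag_common (P : I -> L -> Prop) : U [set i | exists l, P i l] ->
  exists l : ultrapower L, U [set i | P i (urepr l i)].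
Proof.
move=> UP; pose h i := xget l0 [set l | P i l]; exists (uclass h).
apply: filterS (filterI UP (uclass_repr h)) => i [[l Pl] /= ->].
by apply: (@xgetPex _ l0 [set l | P i l]); exists l.
Qed.

(** Enumerate the bag in each factor. By pigeonhole, a member has the same position [j] in almost
    all factors, so it is the class of the [j]-th entries. *)
Lemma ubag_card l : (ubag l #<= `I_k.+1)%card.
Proof.
have [e eP] := choice (fun i => Hb_size i (urepr l i)).
apply: (@card_le_trans _ _ _ [set uclass (e^~ j) | j in `I_k.+1]); last first.
  exact: card_image_le.
apply: subset_card_le => x xl.
have : U [set i | exists2 j, (j < k.+1)%N & e i j = urepr x i].
  by apply: filterS xl => i /eP[j jk ej]; exists j.
by move=> /ultra_pigeonhole[j jk ej]; exists j => //; exact: uclass_eq.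
Qed.

Lemma ugraph_line :
  line_decomposition (fun l => (val : ugraph -> _) @^-1` ubag l).
Proof.
have edge (x y : ugraph) : adj x y -> exists l, ubag l (val x) /\ ubag l (val y).
  move=> /asboolP xy.
  have [|l lP] := @ubag_common (fun i l =>
    Hb i l (urepr (val x) i) /\ Hb i l (urepr (val y) i)).
    by apply: filterS xy => i /Ha_bag.
  by exists l; split; apply: filterS lP => i [].
split=> [x|x y|l l' l'' ll' l'l'' x [xl xl'']]; last 2 [exact: edge].
- have [v vx] := ugraph_near x.
  (* In the factors, bags are only known to contain images and ends of edges; a kept vertex, as the
     end of a walk from an image, is one or the other. *)
  have [<-|[z zx]] := joined_last vx; last first.
    by have [l []] := edge _ _ zx; exists l.
  have [l lP] := @ubag_common (fun i l => Hb i l (phi i v)) (phi_bag v); exists l.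
  by apply: filterS (filterI lP (uclass_repr (phi^~ v))) => i [/= + ->].
- have {}xl : U [set i | Hb i (urepr l i) (urepr (val x) i)] by [].
  have {}xl'' : U [set i | Hb i (urepr l'' i) (urepr (val x) i)] by [].
  suff : U [set i | Hb i (urepr l' i) (urepr (val x) i)] by [].
  apply: filterS (filterI (filterI (ultra_leP ll') (ultra_leP l'l''))
    (filterI xl xl'')) => i [[/= lei lei'] xi].
  exact: (Hb_convex lei lei' xi).
Qed.

Lemma ugraph_line_width (R : realType) : (line_width R ugraph <= k%:R%:E)%E.
Proof.
apply: ge_ereal_inf; exists (width R (fun l => (val : ugraph -> _) @^-1` ubag l)).
  by exists d, (ultrapower L), (fun l => (val : ugraph -> _) @^-1` ubag l);
    split => //; exact: ugraph_line.
apply: ge_ereal_sup => _ [l _ <-].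
have le : ((val : ugraph -> _) @^-1` ubag l #<= `I_k.+1)%card.
  apply: card_le_trans (ubag_card l); apply: card_ge_preimage.
  by move=> x y _ _; exact: val_inj.
have /finite_setP[n nE] : finite_set ((val : ugraph -> _) @^-1` ubag l).
  by apply/finite_set_leP; exists k.+1.
have nk : (n <= k.+1)%N.
  move: nE; rewrite card_eq_le -card_le_II => /andP[_ nA].
  exact: card_le_trans nA le.
rewrite leeBlDr // -EFinD natr1; apply: ge_ereal_inf.
by exists n%:R%:E; [exists n | rewrite lee_fin ler_nat].
Qed.

End UltraGraph.
End Ultrapower.

(** * Infinite graphs *)

Section Distance.
Context (R : realType) (G : graph).

Lemma dist_joined (u v : G) m :
  joined (@adj G) m u v -> (dist R u v <= m%:R%:E)%E.
Proof.
move=> /joinedP[p [up pv pm]]; apply: ge_ereal_inf.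
by exists (size p)%:R%:E; [exists p | rewrite lee_fin ler_nat].
Qed.

Lemma dist_fin (u v : G) : (dist R u v < +oo)%E ->
  exists2 m : nat, joined (@adj G) m u v & dist R u v = m%:R%:E.
Proof.
move=> uv; have [ex|no] := pselect (exists m, `[< joined (@adj G) m u v >]).
  case: (ex_minnP ex) => n /asboolP un nmin.
  exists n => //; apply/eqP; rewrite eq_le dist_joined //=.
  apply: le_ereal_inf_tmp => _ [p [up pv] <-]; rewrite lee_fin ler_nat.
  by apply: nmin; apply/asboolP/joinedP; exists p.
suff d0 : dist R u v = +oo%E by rewrite d0 ltxx in uv.
rewrite -(ereal_inf0 R); congr ereal_inf; apply/seteqP.
split=> // x [p [up pv] _]; case: no.
by exists (size p); apply/asboolP/joinedP; exists p.
Qed.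

Lemma joined_dist (u v : G) (r : R) : 0 <= r -> (dist R u v <= r%:E)%E ->
  joined (@adj G) (Num.truncn r) u v.
Proof.
move=> r0 uvr; have [|m um uvm] := @dist_fin u v.
  by apply: le_lt_trans uvr _; exact: ltry.
by apply: joined_leq um; rewrite truncn_ge_nat // -lee_fin -uvm.
Qed.

End Distance.

Lemma joined_quasi_isometry (R : realType) (G H : graph) (phi : G -> H)
    (M K c : nat) :
  (forall u v, adj u v -> joined (@adj H) M (phi u) (phi v)) ->
  (forall h u v, joined (@adj H) h (phi u) (phi v) ->
    joined (@adj G) (h * K + c) u v) ->
  (forall y, exists v, joined (@adj H) M (phi v) y) ->
  quasi_isometry ((M + K)%:R : R) (M + c)%:R phi.
Proof.
move=> up down onto; split=> [u v /dist_fin[m uv ->]|u v /dist_fin[h uv ->]|y].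
- have /(dist_joined R) := joined_chain up uv.
  move=> /le_trans; apply; rewrite -EFinM -EFinD lee_fin -natrM -natrD ler_nat.
  lia.
- have /(dist_joined R) := down _ _ _ uv.
  move=> /le_trans; apply; rewrite -EFinM -EFinD lee_fin -natrM -natrD ler_nat.
  lia.
- have [v vy] := onto y; exists v; apply: le_trans (dist_joined R vy) _.
  by rewrite lee_fin ler_nat leq_addr.
Qed.

(** A nonempty set of diameter at most [r] lies in the ball around any of its points; for an empty
    set, [v0] serves as the centre. *)
Lemma ball_cover (R : realType) (G : graph) (k : nat) (r : R) (X : set G) (v0 : G) :
  0 <= r -> union_of_at_most k r X ->
  exists Z : seq {classic G}, (size Z <= k)%N /\
    forall u, X u -> exists2 z, z \in Z & joined (@adj G) (Num.truncn r) z u.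
Proof.
move=> r0 [j [Y [jk XY Yr]]]; pose z i := @xget {classic G} v0 (Y i).
exists [seq z i | i <- enum 'I_j]; split; first by rewrite size_map size_enum_ord.
move=> u; rewrite XY => -[i _ Yu]; exists (z i).
  by apply: map_f; rewrite mem_enum.
apply: joined_dist => //; apply: le_trans (Yr i); apply: ereal_sup_ubound.
exists (z i, u) => //; split => //.
by apply: (@xgetPex {classic G} v0 (Y i)); exists u.
Qed.

(** One index is chosen for each pair from [F], diagonal pairs included so that each vertex of [F]
    gets a bag. The indices are sorted and the bags cut down to [F]. *)
Lemma finite_bags (G : graph) (d : Order.disp_t) (T : orderType d)
    (B : T -> set G) (t0 : T) (F : seq {classic G}) :
  line_decomposition B ->
  exists (n : nat) (b : nat -> seq {classic G}), [/\
    forall t t' t'' u, (t <= t')%N -> (t' <= t'')%N ->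
      u \in b t -> u \in b t'' -> u \in b t',
    forall t, (n <= t)%N -> b t = [::],
    forall i, exists t, forall u, u \in b i -> B t u &
    forall u v : G, u \in (F : seq {classic G}) -> v \in (F : seq {classic G}) ->
      u = v \/ adj u v -> exists t, u \in b t /\ v \in b t].
Proof.
case=> Bv Be Bc.
have [tm tmP] : {tm : G * G -> T & forall p, p.1 = p.2 \/ adj p.1 p.2 ->
    B (tm p) p.1 /\ B (tm p) p.2}.
  apply: (@choice _ _ (fun p t => p.1 = p.2 \/ adj p.1 p.2 -> B t p.1 /\ B t p.2)).
  case=> u v /=; have [uv|no] := pselect (u = v \/ adj u v); last by exists t0.
  by case: uv => [<-|/Be[t ?]]; [have [t ?] := Bv u|]; exists t.
pose s := sort <=%O [seq tm (u, v) | u <- F, v <- F].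
pose b i : seq {classic G} :=
  if (i < size s)%N then [seq u <- F | `[< B (nth t0 s i) u >]] else [::].
have bP i u : u \in b i ->
    [/\ (i < size s)%N, B (nth t0 s i) u & u \in F].
  by rewrite /b; case: ifP => // _; rewrite mem_filter => /andP[/asboolP].
exists (size s), b.
split=> [t t' t'' u tt' t't'' /bP[_ ut uF] /bP[t''s ut'' _]|t|i|u v uF vF uv].
- have t's := leq_ltn_trans t't'' t''s.
  have ss : sorted <=%O s by apply: sort_sorted; exact: le_total.
  have nths := sorted_leq_nth le_trans lexx t0 ss.
  rewrite /b t's mem_filter uF andbT; apply/asboolP.
  by apply: (Bc (nth t0 s t) _ (nth t0 s t'')) => //;
    apply: nths; rewrite ?inE //; exact: leq_ltn_trans t's.
- by rewrite /b ltnNge => ->.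
- by exists (nth t0 s i) => u /bP[].
- have ps : tm (u, v) \in s.
    rewrite mem_sort.
    exact: (@allpairs_f {classic G} {classic G} T (fun u v => tm (u, v))).
  have [Bu Bw] := tmP (u, v) uv.
  exists (index (tm (u, v)) s); rewrite /b index_mem ps nth_index //.
  by rewrite !(@mem_filter {classic G}) uF vF !andbT; split; apply/asboolP.
Qed.

Lemma date_leq_lexi (p q : nat *l nat) : (p <= q)%O -> date_leq p q.
Proof.
case: p q => [p1 p2] [q1 q2]; rewrite lexi_pair /date_leq /=.
by rewrite !leEnat; case: ltngtP => //=; lia.
Qed.

Lemma empty_line_width (R : realType) (k : nat) (G : graph) (d : Order.disp_t)
    (T : orderType d) (B : T -> set G) :
  (G -> False) -> line_decomposition B -> (line_width R G <= k%:R%:E)%E.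
Proof.
move=> G0 dB; apply: ge_ereal_inf; exists (width R B); first by exists d, T, B.
apply: ge_ereal_sup => _ [t _ <-]; rewrite leeBlDr //.
apply: ge_ereal_inf; exists 0%:E; last by rewrite -EFinD lee_fin addr_ge0.
have -> : B t = set0 by apply/seteqP; split => // u; case: (G0 u).
by exists 0%N => //=; rewrite II0 card_eq00.
Qed.

(** The cones of lists containing a given list generate a proper filter, because concatenation
    bounds two lists; any ultrafilter above it will do. *)
Lemma ultra_finite_supsets (V : Type) : exists U : set_system (seq {classic V}),
  UltraFilter U /\ forall F : seq {classic V},
    U [set F' : seq {classic V} | {subset F <= F'}].
Proof.
pose U0 : set_system (seq {classic V}) :=
  [set S | exists F : seq {classic V}, forall F' : seq {classic V},
      {subset F <= F'} -> S F'].
have U0P : ProperFilter U0.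
  apply: Build_ProperFilter_ex; first by move=> S [F FS]; exists F; exact: FS.
  split=> [|S S' [F FS] [F' F'S']|S S' SS' [F FS]]; first by exists [::].
    exists (F ++ F') => E FE; split; [apply: FS | apply: F'S'] => u uF;
      by apply: FE; rewrite mem_cat uF ?orbT.
  by exists F => F' /FS /SS'.
have [U [UU UU0]] := ultraFilterLemma U0P.
by exists U; split => // F; apply: UU0; exists F.
Qed.

Theorem mainTheorem4 (R : realType) (k : nat) (r : R) (hr : 0 <= r) :
  exists L C : R, 1 <= L /\ 1 <= C /\
    forall (G : graph) (d : Order.disp_t) (T : orderType d) (B : T -> set G),
      line_decomposition B ->
      (forall t : T, union_of_at_most k r (B t)) ->
      exists (H : graph) (phi : G -> H),
        quasi_isometry L C phi /\ (line_width R H <= k%:R%:E)%E.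
Proof.
(* [M] bounds the walk that realises an edge of [G], [K] the length in [G] of an edge of a finite
   stage, and [D] the distance from a vertex to its centre. *)
pose r0 := Num.truncn r; pose M := (6 * k + 7)%N.
pose K := reach k r0; pose D := sep k r0 0.
exists (M + K)%:R, (M + (2 * D))%:R; rewrite !ler1n; split; first by rewrite /M; lia.
split; first by rewrite /M; lia.
move=> G d T B dB kB; case: (dB) => Bv _ _.
(* The empty graph is mapped to itself; otherwise [v0] and a bag index [t0] supply default
   values. *)
have [[v0]|no] := pselect (exists v : G, True); last first.
  have G0 : G -> False by move=> v; case: no; exists v.
  exists G, id; split; last exact: empty_line_width dB.
  by split=> u; case: (G0 u).
move=> _; have [t0 _] := Bv v0.
pose V := {classic G}; pose X : Type := (V * nat)%type.
pose near (c : nat) : rel V := fun u v => `[< joined (@adj G) c u v >].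
have near_refl c u : near c u u by apply/asboolP; exact: joined_refl.
have near_sym c u v : near c u v -> near c v u.
  by move=> /asboolP uv; apply/asboolP; exact: joined_sym (@adj_sym G) uv.
have near_trans a b u v w : near a u v -> near b v w -> near (a + b)%N u w.
  by move=> /asboolP uv /asboolP vw; apply/asboolP; exact: joined_trans uv vw.
have near_leq a b u v : (a <= b)%N -> near a u v -> near b u v.
  by move=> ab /asboolP uv; apply/asboolP; exact: joined_leq uv.
pose spec (F : seq V)
    (p : (rel X * (nat * nat -> seq (V * nat)%type) * (V -> X))%type) :=
  [/\ symmetric p.1.1 /\ irreflexive p.1.1,
  forall i, (size (p.1.2 i) <= k.+1)%N,
  forall i j i' x, date_leq i j -> date_leq j i' ->
    x \in p.1.2 i -> x \in p.1.2 i' -> x \in p.1.2 j,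
  forall x y, p.1.1 x y -> near K x.1 y.1 /\
    exists i, x \in p.1.2 i /\ y \in p.1.2 i &
  (forall u, u \in F -> (exists i, p.2 u \in p.1.2 i) /\ near D u (p.2 u).1) /\
  (forall u v, u \in F -> v \in F -> @adj G u v ->
    joined p.1.1 M (p.2 u) (p.2 v))].
have [p pP] : {p & forall F, spec F (p F)}.
  apply: choice => F.
  have [n [b [bc be bB bF]]] := finite_bags t0 F dB.
  have [|Ha [Hb [phi [h1 h2 h3 h4 [h5 h6]]]]] :=
    @finite_stage V near near_refl near_sym near_trans near_leq k r0 n b bc be.
    move=> i; have [t bt] := bB i; have [Z [Zk ZB]] := ball_cover v0 hr (kB t).
    by exists Z; split => // u /bt /ZB[z zZ zu]; exists z => //; exact/asboolP.
  exists (Ha, Hb, phi); split => //; split=> [u uF|u v uF vF uv].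
    by have [|t [ut _]] := bF u u uF uF; [left | exact: h5 ut].
  have [|t [ut vt]] := bF u v uF vF; first by right.
  by apply: (h6 t) => //; apply/asboolP; exact: joined_step.
have [U [UU Usup]] := ultra_finite_supsets G.
have Uin u : U [set F | u \in F].
  by apply: filterS (Usup [:: u]) => F; apply; rewrite mem_head.
pose Ha F : rel X := (p F).1.1.
pose Hb F (l : nat *l nat) : set X := [set x | x \in (p F).1.2 l].
pose phi F : G -> X := (p F).2.
have Hs F : symmetric (Ha F) by case: (pP F) => -[].
have Hi F : irreflexive (Ha F) by case: (pP F) => -[].
have Hbag F x y : Ha F x y -> exists l, Hb F l x /\ Hb F l y.
  by case: (pP F) => _ _ _ h _ /h[].
have phibag v : U [set F | exists l, Hb F l (phi F v)].
  by apply: filterS (Uin v) => F vF; case: (pP F) => _ _ _ _ [/(_ v vF)[]].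
exists (@ugraph _ U UU X G Ha phi M Hs Hi), (@umap _ U UU X G Ha phi M Hs Hi).
split; last first.
  apply: (@ugraph_line_width _ U UU X G _ _ ((0, 0) : nat *l nat) Ha Hb) => //.
    move=> F l; exists (nth ((v0 : V), 0%N) ((p F).1.2 l)) => x xl.
    exists (index x ((p F).1.2 l)); last by rewrite nth_index.
    case: (pP F) => _ h _ _ _; apply: leq_trans (h l).
    by rewrite /= index_mem.
  move=> F l l' l'' /date_leq_lexi h1 /date_leq_lexi h2 x [x1 x2].
  by case: (pP F) => _ _ h _ _; exact: h h1 h2 x1 x2.
apply: (@joined_quasi_isometry R _ _ _ M K (2 * D)) => [u v uv|h u v uv|y].
- apply: joined_ball => //.
  apply: (@joined_uclass _ U UU X (v0, 0%N) Ha M (phi^~ u) (phi^~ v)).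
  apply: filterS (filterI (Uin u) (Uin v)) => F [uF vF].
  by case: (pP F) => _ _ _ _ [_]; apply.
- have /joined_ugraph/joined_urepr huv := uv.
  (* A single stage [F] contains [u] and [v] and realises the whole walk: each of its [h] steps
     costs at most [K], and each end costs [D]. *)
  have [F [[hF [uE vE]] [uF vF]]] := filter_ex (filterI (filterI huv
    (filterI (uclass_repr UU (phi^~ u)) (uclass_repr UU (phi^~ v))))
    (filterI (Uin u) (Uin v))).
  move: hF; rewrite /= /uphi uE vE => hF.
  case: (pP F) => _ _ _ hK [hphi _].
  have [_ /asboolP uD] := hphi u uF; have [_ /asboolP vD] := hphi v vF.
  have mid : joined (@adj G) (h * K) (phi F u).1 (phi F v).1.
    by apply: (joined_chain _ hF) => x y /hK[/asboolP].
  apply: joined_leq (joined_trans (joined_trans uD mid)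
    (joined_sym (@adj_sym G) vD)); lia.
- exact: ugraph_near.
Qed.
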